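(* Let $G=(V,E)$ be an infinite, connected graph with finite maximum degree $\Delta$ and contour constant $R_G$. Suppose that (i) $R_G>0$ and (ii) $G$ has a bi-infinite geodesic. Then $G$ has a non-trivial percolation threshold for Bernoulli bond percolation, and $$p_c(G)\le 1-\frac{1}{2\,(2e\Delta^2)^{1/R_G}}.$$
   Context: Graphs are simple; $d_G$ is the graph (path) distance; $\Delta=\max_{v\in V}|\partial_e\{v\}|$. For $W\subset V$: $\partial_e W=\{e\in E: |e\cap W|=1\}$ (edge boundary), $\partial^{\rm ext}_v W=\{x\in V\setminus W: d_G(x,W)=1\}$, $E[W]$ the set of edges with both endpoints in $W$. $\mathcal{A}_G$ is the set of nonempty finite $W\subset V$ whose induced subgraph $G[W]$ is connected. For $W\in\mathcal{A}_G$, the tree distance $d^{\rm t}_G(\partial_e W)$ is the minimum number of edges of a tree $T$ which is a subgraph of the graph with vertex set $W\cup\partial^{\rm ext}_vW$ and edge set $E[W]\cup\partial_eW$ and whose edge set contains $\partial_e W$. The contour constant is $R_G=\inf_{W\in\mathcal{A}_G}|\partial_eW|/d^{\rm t}_G(\partial_eW)$. A geodesic ray is an infinite path $x_0,x_1,x_2,\dots$ with $d_G(x_0,x_n)=n$ for all $n$; two geodesic rays $x_0,x_1,\dots$ and $x_0,y_1,y_2,\dots$ from the same vertex form a bi-infinite geodesic if $d_G(x_n,y_m)=n+m$ for all $n,m\in\mathbb{N}$. Bernoulli bond percolation with parameter $p$: edges independently open with probability $p$; $\theta_p(x)$ is the probability that $x$ lies in an infinite open cluster; $p_c(G)=\sup\{p:\theta_p(x)=0\}$.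 *)

(* Defs.v *)
From HB Require Import structures.
From mathcomp Require Import all_boot all_order all_algebra finmap.
From mathcomp Require Import all_classical all_reals.
From mathcomp Require Import all_analysis.
Set Implicit Arguments. Unset Strict Implicit. Unset Printing Implicit Defensive.
Import Order.TTheory GRing.Theory Num.Theory.
Local Open Scope ring_scope.
Local Open Scope fset_scope.

(* Graphs.  A (possibly infinite) graph on a vertex type V is given by  *)
(* its (finite) neighbourhoods nbr x : {fset V}.  Every graph with      *)
(* finite maximum degree is of this form.  An (unordered) edge {x,y} is *)
(* the two-element finite set [fset x; y].                              *)

Definition simple_graph (V : choiceType) (nbr : V -> {fset V}) : Prop :=
  (forall x, x \notin nbr x) /\ (forall x y, (y \in nbr x) = (x \in nbr y)).

Definition adjb (V : choiceType) (nbr : V -> {fset V}) : rel V :=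
  fun x y => y \in nbr x.

Definition is_edge (V : choiceType) (nbr : V -> {fset V}) (e : {fset V}) : Prop :=
  exists x y, y \in nbr x /\ e = [fset x; y].

Definition walk (V : choiceType) (nbr : V -> {fset V}) (n : nat) (x y : V) : Prop :=
  exists s : seq V, [/\ size s = n, path (adjb nbr) x s & last x s = y].

Definition graph_connected (V : choiceType) (nbr : V -> {fset V}) : Prop :=
  forall x y : V, exists n, walk nbr n x y.

Definition graph_infinite (V : choiceType) : Prop := ~ finite_set [set: V].

Definition is_max_degree (V : choiceType) (nbr : V -> {fset V}) (Delta : nat) : Prop :=
  (forall x, #|` nbr x| <= Delta)%N /\ exists x, #|` nbr x| = Delta.

Definition is_dist (V : choiceType) (nbr : V -> {fset V}) (x y : V) (n : nat) : Prop :=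
  walk nbr n x y /\ forall m, walk nbr m x y -> (n <= m)%N.

Definition geodesic_ray (V : choiceType) (nbr : V -> {fset V}) (r : nat -> V) : Prop :=
  (forall n, adjb nbr (r n) (r n.+1)) /\ (forall n, is_dist nbr (r 0%N) (r n) n).

Definition has_biinfinite_geodesic (V : choiceType) (nbr : V -> {fset V}) : Prop :=
  exists r1 r2 : nat -> V,
    [/\ r1 0%N = r2 0%N, geodesic_ray nbr r1, geodesic_ray nbr r2 &
        forall n m, is_dist nbr (r1 n) (r2 m) (n + m)].

Definition connected_in (V : choiceType) (r : rel V) (U : {fset V}) : Prop :=
  forall x y, x \in U -> y \in U ->
    exists s : seq V, [/\ path r x s, all (fun z => z \in U) s & last x s = y].

Definition in_AG (V : choiceType) (nbr : V -> {fset V}) (W : {fset V}) : Prop :=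
  W != fset0 /\ connected_in (fun x y => (y \in nbr x) && (x \in W) && (y \in W)) W.

Definition edge_boundary (V : choiceType) (nbr : V -> {fset V}) (W : {fset V})
  : {fset {fset V}} :=
  [fset [fset x; y] | x in W, y in nbr x & y \notin W].

Definition ext_vboundary (V : choiceType) (nbr : V -> {fset V}) (W : {fset V})
  : {fset V} :=
  [fset y | x in W, y in nbr x & y \notin W].

Definition frel (V : choiceType) (F : {fset {fset V}}) : rel V :=
  fun x y => [fset x; y] \in F.

Definition is_tree (V : choiceType) (U : {fset V}) (F : {fset {fset V}}) : Prop :=
  [/\ U != fset0,
      (forall e, e \in F -> exists x y, [/\ x \in U, y \in U, x != y & e = [fset x; y]]),
      connected_in (frel F) U &
      ~ (exists s : seq V,
           [/\ (3 <= size s)%N, uniq s, all (fun z => z \in U) s & cycle (frel F) s])].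

Definition contour_tree (V : choiceType) (nbr : V -> {fset V}) (W : {fset V})
  (U : {fset V}) (F : {fset {fset V}}) : Prop :=
  [/\ is_tree U F,
      U `<=` (W `|` ext_vboundary nbr W),
      (forall e, e \in F ->
         (exists x y, [/\ y \in nbr x, e = [fset x; y] & (x \in W) && (y \in W)])
         \/ e \in edge_boundary nbr W) &
      edge_boundary nbr W `<=` F].

Local Close Scope fset_scope.
Local Open Scope classical_set_scope.

Definition tree_dist (R : realType) (V : choiceType) (nbr : V -> {fset V})
  (W : {fset V}) : R :=
  inf [set (#|` F|%:R : R) | F in [set F | exists U, contour_tree nbr W U F]].

Definition contour_constant (R : realType) (V : choiceType) (nbr : V -> {fset V}) : R :=
  inf [set (#|` edge_boundary nbr W|%:R / tree_dist R nbr W : R)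
      | W in [set W | in_AG nbr W]].

Definition bernoulli_bond_percolation (R : realType) (V : choiceType)
  (nbr : V -> {fset V}) (p : R) (d : measure_display) (T : measurableType d)
  (P : probability T R) (omega : T -> {fset V} -> bool) : Prop :=
  [/\ (forall e, is_edge nbr e -> measurable [set t | omega t e]),
      (forall e, is_edge nbr e -> P [set t | omega t e] = p%:E) &
      (forall F : {fset {fset V}}, (forall e, e \in F -> is_edge nbr e) ->
         P (\bigcap_(e in [set` F]) [set t | omega t e]) = (p ^+ #|` F|)%:E)].

Definition open_cluster (V : choiceType) (nbr : V -> {fset V})
  (w : {fset V} -> bool) (x : V) : set V :=
  [set y | exists s : seq V,
     path (fun a b => (b \in nbr a) && w [fset a; b]%fset) x s /\ last x s = y].

Definition infinite_cluster_event (V : choiceType) (nbr : V -> {fset V}) (T : Type)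
  (omega : T -> {fset V} -> bool) (x : V) : set T :=
  [set t | ~ finite_set (open_cluster nbr (omega t) x)].

Definition theta_zero (R : realType) (V : choiceType) (nbr : V -> {fset V})
  (p : R) (x : V) : Prop :=
  forall (d : measure_display) (T : measurableType d) (P : probability T R)
         (omega : T -> {fset V} -> bool),
    bernoulli_bond_percolation nbr p P omega ->
    P (infinite_cluster_event nbr omega x) = 0%E.

Definition p_c (R : realType) (V : choiceType) (nbr : V -> {fset V}) (x : V) : R :=
  sup [set p : R | 0 <= p <= 1 /\ theta_zero nbr p x].

(* Main.v *)
Require Import Defs.
From HB Require Import structures.
From mathcomp Require Import all_boot all_order all_algebra finmap.
From mathcomp Require Import all_classical all_reals.
From mathcomp Require Import all_analysis.
From mathcomp Require Import ring lra.
Import Order.TTheory GRing.Theory Num.Theory.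
Local Open Scope classical_set_scope.
Local Open Scope ring_scope.

Set Implicit Arguments.
Unset Strict Implicit.
Unset Printing Implicit Defensive.

(* Peierls argument. If the cluster W of x is finite, all edges of its edge
   boundary are closed. A contour tree of W with k edges contains an edge of each
   half of the bi-infinite geodesic, hence an edge leaving the n-th vertex of the
   first ray for some n < k - 1. Going twice along each edge, the tree is swept by
   a walk of length 2k from that vertex, so there are at most k Delta^(2k) 2^k
   candidates for the boundary, which has at least R_G k edges; when
   (1 - p)^(R_G) <= 1 / (2 e Delta^2) the expected number of closed ones is at most
   the sum of the (k - 1) e^(-k), which is less than 1. To reach an arbitrary
   vertex x rather than the origin of the geodesic, the union bound is made jointly
   with the event that a fixed path between the two is open: that event forces a
   factor p^g in each term, so no correlation inequality is needed.
   Since theta_zero speaks of all realizations of percolation, one must be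
   exhibited: the edges are numbered and the state of the n-th one is the n-th
   digit of a uniform point of [0, 1[ in an expansion with weights p and 1 - p. *)

(** * Walks, the edges they traverse, and walks that sweep a connected edge set *)

(** A set and not a list: an edge traversed several times counts once, so a walk of length [2 * k]
    can have only [k] edges. *)
Fixpoint walk_edges (V : choiceType) (x : V) (s : seq V) : {fset {fset V}} :=
  if s is y :: s' then ([fset x; y] |` walk_edges y s')%fset else fset0.

Lemma walk_edges_cat (V : choiceType) (x : V) (s1 s2 : seq V) :
  walk_edges x (s1 ++ s2) = (walk_edges x s1 `|` walk_edges (last x s1) s2)%fset.
Proof.
elim: s1 x => [|y s1 IH] x /=; first by rewrite fset0U.
by rewrite IH fsetUA.
Qed.

Lemma walk_edges_endpoint (V : choiceType) (x : V) (s : seq V) (e : {fset V}) (v : V) :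
  e \in walk_edges x s -> v \in e -> v \in x :: s.
Proof.
elim: s x => [|y s IH] x /=; first by rewrite inE.
rewrite !inE => /orP[/eqP->|es ve].
  by rewrite !inE => /orP[/eqP->|/eqP->]; rewrite eqxx ?orbT.
by have := IH _ es ve; rewrite !inE => ->; rewrite orbT.
Qed.

(** If the first edge recurred later, its initial vertex [x] would be visited twice. *)
Lemma card_walk_edges_uniq (V : choiceType) (x : V) (s : seq V) :
  uniq (x :: s) -> #|` walk_edges x s| = size s.
Proof.
elim: s x => [|y s IH] x; first by rewrite cardfs0.
rewrite [uniq _]/= -/(uniq (y :: s)) => /andP[xys us].
rewrite [walk_edges _ _]/= cardfsU1 IH // -[size (y :: s)]/(1 + size s)%N.
congr (_ + _)%N; case: (boolP (_ \in walk_edges _ _)) => //= /walk_edges_endpoint => /(_ x).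
by rewrite !inE eqxx => /(_ isT); move: xys; rewrite !inE => /negbTE->.
Qed.

(** Separates the deterministic part of an open walk, its adjacencies, from the random part, the
    states of finitely many edges. *)
Lemma path_adj_open (V : choiceType) (nbr : V -> {fset V}) (w : {fset V} -> bool)
    (x : V) (s : seq V) :
  path (fun a b => (b \in nbr a) && w [fset a; b]%fset) x s <->
  path (adjb nbr) x s /\ (forall e, e \in walk_edges x s -> w e).
Proof.
elim: s x => [|y s IH] x /=; first by split => // _; split => // e; rewrite inE.
split.
- case/andP=> /andP[xy wxy] /IH [ps ws]; split; first by rewrite /adjb xy.
  by move=> e; rewrite !inE => /orP[/eqP->//|/ws].
- case=> /andP[xy ps] ws; apply/andP; split.
    by rewrite -/(adjb nbr x y) xy ws // !inE eqxx.
  by apply/IH; split => // e es; apply: ws; rewrite !inE es orbT.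
Qed.

Lemma path_frel (V : choiceType) (F : {fset {fset V}}) (x : V) (s : seq V) :
  path (Defs.frel F) x s = (walk_edges x s `<=` F)%fset.
Proof.
elim: s x => [|y s IH] x /=; first by rewrite fsub0set.
by rewrite IH fsubUset fsub1set.
Qed.

Lemma walk_edges_is_edge (V : choiceType) (nbr : V -> {fset V}) (x : V) (s : seq V) e :
  path (adjb nbr) x s -> e \in walk_edges x s -> is_edge nbr e.
Proof.
elim: s x => [|y s IH] x /=; first by rewrite inE.
case/andP=> xy ps; rewrite !inE => /orP[/eqP->|]; last exact: IH.
by exists x, y.
Qed.

Fixpoint walks (V : choiceType) (nbr : V -> {fset V}) (n : nat) (x : V) : seq (seq V) :=
  if n is m.+1 then [seq y :: s | y <- enum_fset (nbr x), s <- walks nbr m y]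
  else [:: [::]].

Lemma mem_walks (V : choiceType) (nbr : V -> {fset V}) (n : nat) (x : V) (s : seq V) :
  (s \in walks nbr n x) = (size s == n) && path (adjb nbr) x s.
Proof.
elim: n x s => [|n IH] x s /=; first by rewrite inE; case: s.
apply/allpairsPdep/idP => [[y [s' [yx s'y ->]]]|].
  by move: s'y; rewrite IH /= eqSS => /andP[-> ->]; rewrite /adjb yx.
case: s => [|y s] //= /andP[sn /andP[xy ps]].
by exists y, s; split => //; rewrite IH -eqSS sn.
Qed.

Lemma size_flatten_le (T S : eqType) (l : seq T) (t : T -> seq S) (m : nat) :
  (forall x, x \in l -> (size (t x) <= m)%N) ->
  (size (flatten [seq t x | x <- l]) <= size l * m)%N.
Proof.
elim: l => [|a l IH] //= h; rewrite size_cat mulSn leq_add ?h ?inE ?eqxx //.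
by apply: IH => x xl; apply: h; rewrite inE xl orbT.
Qed.

Lemma size_walks_le (V : choiceType) (nbr : V -> {fset V}) (D n : nat) (x : V) :
  (forall x, (#|` nbr x| <= D)%N) -> (size (walks nbr n x) <= D ^ n)%N.
Proof.
move=> hD; elim: n x => [|n IH] x //=.
apply: leq_trans (_ : #|` nbr x| * D ^ n <= _)%N; last by rewrite expnS leq_mul2r hD orbT.
by apply: size_flatten_le => y _; rewrite size_map.
Qed.

(* A walk of length 2j covering j edges is enlarged by a detour a, b, a along
   an uncovered edge issued from a visited vertex a. *)
Lemma covering_walk_extend (V : choiceType) (F : {fset {fset V}}) (v : V)
    (s : seq V) (a b : V) :
  path (Defs.frel F) v s -> a \in v :: s -> [fset a; b]%fset \in F ->
  [fset a; b]%fset \notin walk_edges v s ->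
  exists s', [/\ path (Defs.frel F) v s', size s' = (size s).+2 &
                 #|` walk_edges v s'| = #|` walk_edges v s|.+1].
Proof.
move=> ps; rewrite inE => avs abF abs.
have [s1 [s2 [sE al]]] : exists s1 s2, s = s1 ++ s2 /\ last v s1 = a.
  case/orP: avs => [/eqP->|sa]; first by exists [::], s.
  by case: (splitPr sa) => p1 p2; exists (p1 ++ [:: a]), p2; rewrite -catA last_cat.
exists (s1 ++ b :: a :: s2).
have E : walk_edges v (s1 ++ b :: a :: s2) = ([fset a; b] |` walk_edges v s)%fset.
  rewrite sE !walk_edges_cat al /= (fsetUC [fset b]%fset).
  by apply/fsetP => e; rewrite !inE; case: (e == _); rewrite ?orbT.
rewrite path_frel E fsubUset fsub1set abF -path_frel ps cardfsU1 abs sE !size_cat /=.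
by split => //; rewrite !addnS.
Qed.

(** As long as an edge is uncovered, connectivity gives an uncovered edge issued from a visited
    vertex; each detour costs two steps and gains one edge. *)
Lemma covering_walk (V : choiceType) (U : {fset V}) (F : {fset {fset V}}) (v : V) :
  (forall e, e \in F -> exists x y, [/\ x \in U, y \in U, x != y & e = [fset x; y]%fset]) ->
  connected_in (Defs.frel F) U -> v \in U ->
  exists s, [/\ path (Defs.frel F) v s, size s = (2 * #|` F|)%N & walk_edges v s = F].
Proof.
move=> FU conn vU.
have step j : (j <= #|` F|)%N -> exists s, [/\ path (Defs.frel F) v s, size s = (2 * j)%N &
    #|` walk_edges v s| = j].
  elim: j => [|j IH] jF; first by exists [::]; rewrite cardfs0.
  have [s [ps ss cs]] := IH (ltnW jF).
  have [a [b [avs abF abs]]] : exists a b, [/\ a \in v :: s, [fset a; b]%fset \in F &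
      [fset a; b]%fset \notin walk_edges v s].
    have [e eF es] : exists2 e, e \in F & e \notin walk_edges v s.
      apply: contrapT => h; suff /fsubset_leq_card : (F `<=` walk_edges v s)%fset.
        by rewrite cs leqNgt jF.
      apply/fsubsetP => e eF; apply: contrapT => es; apply: h; exists e => //.
      exact/negP.
    have [x [y [xU yU _ eE]]] := FU _ eF.
    have [t [pt _ lt]] := conn v x vU xU.
    have {t pt lt} [t pt tN] : exists2 t, path (Defs.frel F) v t & e \in walk_edges v t.
      exists (t ++ [:: y]); first by rewrite cat_path pt lt /= /Defs.frel -eE eF.
      by rewrite walk_edges_cat lt /= -eE !inE eqxx orbT.
    have vs : v \in v :: s by rewrite inE eqxx.
    (* The start of the path leading through [e] is generalized to any visited vertex. Along the
       path, a covered edge ends at a visited vertex, so the first uncovered edge is the one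
       sought. *)
    have [u [us pu eu]] : exists u, [/\ u \in v :: s, path (Defs.frel F) u t &
        e \in walk_edges u t] by exists v.
    elim: t u us pu eu {pt tN vs} => [|z t IHt] u us /=; first by rewrite inE.
    case/andP=> uzF ptt; rewrite in_fsetU in_fset1 => eut.
    case: (boolP ([fset u; z]%fset \in walk_edges v s)) => uzs; last by exists u, z; split.
    apply: (IHt z) => //; last first.
      by case/orP: eut => // /eqP ez; rewrite ez uzs in es.
    by apply: walk_edges_endpoint uzs _; rewrite !inE eqxx orbT.
  have [s' [ps' ss' cs']] := covering_walk_extend ps avs abF abs.
  by exists s'; rewrite ss' cs' ss cs mulnS.
have [s [ps ss cs]] := step _ (leqnn _).
exists s; split => //; apply/eqP; rewrite eqEfcard -path_frel ps cs leqnn //.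
Qed.

(** * Probabilities of finite sets of open and closed edges, and the union bound *)

Definition open_on (V : choiceType) (T : Type) (omega : T -> {fset V} -> bool)
    (F : {fset {fset V}}) : set T :=
  [set t | forall e, e \in F -> omega t e].

Definition closed_on (V : choiceType) (T : Type) (omega : T -> {fset V} -> bool)
    (S : {fset {fset V}}) : set T :=
  [set t | forall e, e \in S -> ~~ omega t e].

Lemma measurable_open_on (V : choiceType) (d : measure_display) (T : measurableType d)
    (omega : T -> {fset V} -> bool) (F : {fset {fset V}}) :
  (forall e, e \in F -> measurable [set t | omega t e]) ->
  measurable (open_on omega F).
Proof.
move=> mF.
have -> : open_on omega F = \bigcap_(e in [set` F]) [set t | omega t e] by [].
by apply: fin_bigcap_measurable => // e; exact: mF.
Qed.

Lemma measurable_closed_on (V : choiceType) (d : measure_display) (T : measurableType d)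
    (omega : T -> {fset V} -> bool) (S : {fset {fset V}}) :
  (forall e, e \in S -> measurable [set t | omega t e]) ->
  measurable (closed_on omega S).
Proof.
move=> mS.
have -> : closed_on omega S = \bigcap_(e in [set` S]) ~` [set t | omega t e].
  by apply/seteqP; split => t h e eS; have /negP := h e eS.
by apply: fin_bigcap_measurable => // e eS; apply: measurableC; exact: mS.
Qed.

(** The model prescribes only joint probabilities of open edges. Closed ones are recovered one at a
    time from P(A minus B) = P(A) - P(A and B), where B says that [e] is open; in the subtracted
    term [e] passes from [S] to [F], hence the induction for all [F]. *)
Lemma bernoulli_open_closed (R : realType) (V : choiceType) (nbr : V -> {fset V})
    (p : R) (d : measure_display) (T : measurableType d) (P : probability T R)
    (omega : T -> {fset V} -> bool) (F S : {fset {fset V}}) :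
  bernoulli_bond_percolation nbr p P omega ->
  (forall e, e \in F -> is_edge nbr e) -> (forall e, e \in S -> is_edge nbr e) ->
  [disjoint F & S]%fset ->
  P (open_on omega F `&` closed_on omega S) = (p ^+ #|` F| * (1 - p) ^+ #|` S|)%:E.
Proof.
case=> mo _ indep.
have [n] := ubnP #|` S|; elim: n S F => // n IH S F Sn FE SE dFS.
have [S0|[e eS]] := fset_0Vmem S.
  rewrite S0 cardfs0 expr0 mulr1 -indep //; congr (P _).
  by apply/seteqP; split => [t [h _]//|t h]; split => // e; rewrite inE.
set S' := (S `\ e)%fset.
have eF : e \notin F by move: dFS; rewrite fdisjoint_sym => /fdisjointP; exact.
have cS : #|` S| = #|` S'|.+1 by rewrite (cardfsD1 e) eS.
have S'E a : a \in S' -> is_edge nbr a by rewrite !inE => /andP[_]; exact: SE.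
have S'n : (#|` S'| < n)%N by rewrite -ltnS -cS.
have dFS' : [disjoint F & S']%fset.
  by apply/fdisjointP => a aF; rewrite !inE (negbTE (fdisjointP dFS a aF)) andbF.
have deFS' : [disjoint e |` F & S']%fset by rewrite fdisjointU1X dFS' !inE eqxx.
have eFE a : a \in (e |` F)%fset -> is_edge nbr a.
  by rewrite !inE => /orP[/eqP->|]; [exact: SE|exact: FE].
have -> : open_on omega F `&` closed_on omega S =
    (open_on omega F `&` closed_on omega S') `\` [set t | omega t e].
  apply/seteqP; split => [t [oF cSt]|t [[oF cSt] ne]]; split => //.
  - by split => // a; rewrite !inE => /andP[_]; exact: cSt.
  - by apply/negP; apply: cSt.
  - move=> a aS; have [->|ae] := eqVneq a e; first exact/negP.
    by apply: cSt; rewrite !inE ae.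
rewrite measureD; first last.
- by rewrite (le_lt_trans (probability_le1 _ _)) ?ltry //; apply: measurableI;
    [apply: measurable_open_on => a /FE|apply: measurable_closed_on => a /S'E]; exact: mo.
- by apply: mo; exact: SE.
- by apply: measurableI;
    [apply: measurable_open_on => a /FE|apply: measurable_closed_on => a /S'E]; exact: mo.
have -> : open_on omega F `&` closed_on omega S' `&` [set t | omega t e] =
    open_on omega (e |` F)%fset `&` closed_on omega S'.
  apply/seteqP; split => [t [[oF cSt] oe]|t [oeF cSt]].
    by split => // a; rewrite !inE => /orP[/eqP->//|]; exact: oF.
  by split; [split => // a aF; apply: oeF; rewrite !inE aF orbT|apply: oeF; rewrite !inE eqxx].
rewrite [X in (X - _)%E](IH S' F) // [X in (_ - X)%E](IH S' (e |` F)%fset) //.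
rewrite -EFinB cardfsU1 eF cS add1n !exprS.
by move: (p ^+ _) ((1 - p) ^+ _) => a b; congr (_%:E); ring.
Qed.

(** A candidate contour may share an edge with the fixed path; the event is then empty, and the
    inequality still holds. *)
Lemma bernoulli_open_closed_le (R : realType) (V : choiceType) (nbr : V -> {fset V})
    (p : R) (d : measure_display) (T : measurableType d) (P : probability T R)
    (omega : T -> {fset V} -> bool) (F S : {fset {fset V}}) :
  0 <= p <= 1 -> bernoulli_bond_percolation nbr p P omega ->
  (forall e, e \in F -> is_edge nbr e) -> (forall e, e \in S -> is_edge nbr e) ->
  (P (open_on omega F `&` closed_on omega S) <= (p ^+ #|` F| * (1 - p) ^+ #|` S|)%:E)%E.
Proof.
move=> /andP[p0 p1] B FE SE; have [dFS|ndFS] := boolP [disjoint F & S]%fset.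
  by rewrite (bernoulli_open_closed B FE SE dFS).
have [e eF eS] : exists2 e, e \in F & e \in S.
  apply: contrapT => h; move/negP: ndFS; apply; apply/fdisjointP => e eF.
  by apply/negP => eS; apply: h; exists e.
rewrite (_ : _ `&` _ = set0) ?measure0 ?lee_fin ?mulr_ge0 ?exprn_ge0 ?subr_ge0 //.
by apply/seteqP; split => // t [/(_ _ eF) oe /(_ _ eS)]; rewrite oe.
Qed.

Lemma measure_bigsetU_le (R : realType) (d : measure_display) (T : measurableType d)
    (P : probability T R) (I : eqType) (l : seq I) (B : I -> set T) (c : R) :
  (forall i, i \in l -> measurable (B i)) ->
  (forall i, i \in l -> (P (B i) <= c%:E)%E) ->
  measurable (\big[setU/set0]_(i <- l) B i) /\
  (P (\big[setU/set0]_(i <- l) B i) <= ((size l)%:R * c)%:E)%E.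
Proof.
elim: l => [|i l IH] mB PB; first by rewrite big_nil measure0 mul0r.
have [||mU PU] := IH; [by move=> j jl; apply: mB; rewrite inE jl orbT|
  by move=> j jl; apply: PB; rewrite inE jl orbT|].
have mi : measurable (B i) by apply: mB; rewrite inE eqxx.
rewrite big_cons; split; first exact: measurableU.
apply: le_trans (measureU2 _ _ _) _ => //.
rewrite /= -addn1 natrD mulrDl mul1r addrC EFinD leeD //.
by apply: PB; rewrite inE eqxx.
Qed.

Lemma bigsetU_seqP (T : Type) (I : eqType) (l : seq I) (B : I -> set T) (t : T) :
  (\big[setU/set0]_(i <- l) B i) t <-> exists2 i, i \in l & B i t.
Proof.
elim: l => [|j l IH]; first by rewrite big_nil; split => [[]|[]].
rewrite big_cons; split.
  case=> [Bj|/IH[i il Bi]]; first by exists j => //; rewrite inE eqxx.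
  by exists i => //; rewrite inE il orbT.
case=> i; rewrite inE => /orP[/eqP->|il] Bi; [by left|right].
by apply/IH; exists i.
Qed.

(** * A realization of percolation on the unit interval *)

(* The n-th digit of t in the expansion attached to [a, a + w[: at each stage the
   current interval is split in proportion p : 1 - p, and the digit is true on the
   left part. *)
Fixpoint digit (R : realType) (p : R) (n : nat) (a w t : R) : bool :=
  if n is m.+1 then
    if t < a + p * w then digit p m a (p * w) t
    else digit p m (a + p * w) ((1 - p) * w) t
  else t < a + p * w.

(** An entry [true] of [c] forces a digit to be true; an entry [false] imposes nothing, and neither
    do indices past the end, through the default value of [nth]. *)
Definition digit_event (R : realType) (p : R) (c : seq bool) (a w : R) : set R :=
  `[a, (a + w)[%classic `&` [set t | forall i, nth false c i -> digit p i a w t].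

(** Self-similarity: each of the two parts of the interval carries the same event for the tail of
    [c]. A first entry [true] keeps only the left part, hence a factor [p]; a first entry [false]
    keeps both, and their lengths add up to [w]. *)
Lemma lebesgue_digit_event (R : realType) (p : R) (c : seq bool) (a w : R) :
  0 <= p <= 1 -> 0 <= w ->
  measurable (digit_event p c a w : set (measurableTypeR R)) /\
  lebesgue_measure (digit_event p c a w) = (w * p ^+ count id c)%:E.
Proof.
move=> p01; have /andP[p0 p1] := p01; elim: c a w => [|b c IH] a w w0.
  have -> : digit_event p [::] a w = `[a, (a + w)[%classic.
    by apply/seteqP; split => [t []//|t at_]; split => // i; rewrite nth_nil.
  split; first exact: measurable_itv.
  rewrite lebesgue_measure_itv /= lte_fin mulr1 ltrDl; case: ltP => [w1|w1].
    by rewrite -EFinB addrAC subrr add0r.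
  by congr (_%:E); apply/eqP; rewrite eq_le w0 w1.
have pw : 0 <= p * w by rewrite mulr_ge0.
have qw : 0 <= (1 - p) * w by rewrite mulr_ge0 // subr_ge0.
have [m1 l1] := IH a _ pw; have [m2 l2] := IH (a + p * w) _ qw.
have split_w : a + p * w + (1 - p) * w = a + w by ring.
have E : digit_event p (b :: c) a w = digit_event p c a (p * w) `|`
    (if b then set0 else digit_event p c (a + p * w) ((1 - p) * w)).
  apply/seteqP; split => t.
  - case=> /=; rewrite in_itv /= => /andP[at_ ta] h.
    have [tl|tl] := ltP t (a + p * w).
      left; split; rewrite /= ?in_itv /= ?at_ ?tl // => i ci.
      by have := h i.+1 ci; rewrite /= tl.
    right; case: b h => h; first by have := h 0%N isT; rewrite /= ltNge tl.
    split => /=; first by rewrite in_itv /= tl split_w.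
    by move=> i ci; have := h i.+1 ci; rewrite /= ltNge tl.
  - case=> [[/=]|].
      rewrite in_itv /= => /andP[at_ tl] h; split; rewrite /= ?in_itv /=.
        by rewrite at_ (lt_le_trans tl) // lerD2l ler_piMl.
      by case=> [|i] /=; rewrite tl //; exact: h.
    case: b => // -[/=]; rewrite in_itv /= => /andP[tl ta] h; split.
      rewrite /= in_itv /= (le_trans _ tl) ?lerDl //=.
      by move: ta; rewrite split_w.
    by case=> [|i] //= ci; rewrite ltNge tl /=; exact: h.
have m3 : measurable ((if b then set0 else
    digit_event p c (a + p * w) ((1 - p) * w)) : set (measurableTypeR R)).
  by case: (b).
have l3 : lebesgue_measure ((if b then set0 else
    digit_event p c (a + p * w) ((1 - p) * w)) : set (measurableTypeR R)) =
    (if b then 0 else (1 - p) * w * p ^+ count id c)%:E.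
  by case: (b); first exact: measure0.
rewrite E; split; first exact: measurableU.
rewrite measureU //; last first.
  case: (b); first by rewrite setI0.
  apply/seteqP; split => // t [[/=]]; rewrite in_itv /= => /andP[_ tl] _ [/=].
  by rewrite in_itv /= leNgt tl.
apply: etrans (congr2 adde l1 l3) _; congr (_%:E).
by case: (b); rewrite /= ?add1n ?add0n ?exprS; ring.
Qed.

Definition lebesgue01 (R : realType) : set (measurableTypeR R) -> \bar R :=
  mrestr (@lebesgue_measure R) (measurable_itv `[0, 1[ : measurable (_ : set (measurableTypeR R))).

HB.instance Definition _ (R : realType) := Measure.on (@lebesgue01 R).

Lemma lebesgue01_setT (R : realType) : lebesgue01 [set: measurableTypeR R] = 1%E.
Proof.
rewrite /lebesgue01 /mrestr setTI lebesgue_measure_itv /= lte_fin ltr01.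
by rewrite oppr0 adde0.
Qed.

HB.instance Definition _ (R : realType) :=
  Measure_isProbability.Build _ _ _ (@lebesgue01 R) (@lebesgue01_setT R).

Lemma measurable_digit (R : realType) (p : R) (n : nat) (a w : R) :
  measurable ([set t | digit p n a w t] : set (measurableTypeR R)).
Proof.
have mlt (b : R) : measurable ([set t | t < b] : set (measurableTypeR R)).
  rewrite (_ : [set t | t < b] = `]-oo, b[%classic); first exact: measurable_itv.
  by apply/seteqP; split => t; rewrite /= in_itv.
elim: n a w => [|n IH] a w //=.
rewrite (_ : [set t | _] =
   ([set t | t < a + p * w] `&` [set t | digit p n a (p * w) t]) `|`
   (~` [set t | t < a + p * w] `&` [set t | digit p n (a + p * w) ((1 - p) * w) t])).
  apply: measurableU; apply: measurableI => //; exact: measurableC.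
apply/seteqP; split => t /=; first by case: ifP => tl dt; [left|right]; split => //; exact/negP.
by case=> -[]; [move=> -> | move/negP/negbTE=> ->].
Qed.

(** By connectivity each edge is the last one of a finite walk from [x], and there are finitely many
    walks of each length. *)
Lemma countable_edges (V : choiceType) (nbr : V -> {fset V}) (x : V) :
  graph_connected nbr -> countable [set e | is_edge nbr e].
Proof.
move=> conn; pose W n := \bigcup_(s in [set` walks nbr n x]) [set` walk_edges x s].
apply: (@sub_countable _ _ _ (\bigcup_n W n)); last first.
  apply: bigcup_countable => // n _; apply: bigcup_countable => [|s _].
    exact: finite_set_countable.
  exact: countable_fset.
apply: subset_card_le => e [a [b [ab ->]]].
have [n [s [sn ps la]]] := conn x a.
exists n.+1 => //; exists (rcons s b).
  by rewrite /mkset mem_walks size_rcons sn eqxx rcons_path ps la.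
by rewrite /mkset -cats1 walk_edges_cat la /= !inE eqxx orbT.
Qed.

(** The edge [e] reads the digit numbered [f e]. As [f] is injective on edges, distinct edges read
    distinct digits, and these are independent. *)
Lemma bernoulli_exists (R : realType) (V : choiceType) (nbr : V -> {fset V}) (p : R) (x : V) :
  graph_connected nbr -> 0 <= p <= 1 ->
  exists omega : measurableTypeR R -> {fset V} -> bool,
    bernoulli_bond_percolation nbr p (@lebesgue01 R) omega.
Proof.
move=> conn p01; have /countable_injP[f finj] := countable_edges x conn.
pose omega (t : measurableTypeR R) e := digit p (f e) 0 1 t.
exists omega.
have indep (F : {fset {fset V}}) : (forall e, e \in F -> is_edge nbr e) ->
    lebesgue01 (\bigcap_(e in [set` F]) [set t | omega t e]) = (p ^+ #|` F|)%:E.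
  move=> FE; pose A := (f @` F)%fset.
  pose N := (\max_(i <- A) i).+1; have leN i : i \in A -> (i < N)%N.
    by move=> iA; rewrite ltnS; exact: (@leq_bigmax_seq nat _ predT id).
  (* The pattern that forces exactly the digits read by the edges of [F]; [N] exceeds all their
     numbers. *)
  pose c := mkseq (fun i => i \in A) N.
  have nthc i : nth false c i = (i \in A).
    have [iN|iN] := ltnP i N; first by rewrite nth_mkseq.
    rewrite nth_default ?size_mkseq //; apply/esym/negbTE/negP => iA.
    by move: iN; rewrite leqNgt leN.
  have cc : count id c = #|` F|.
    have <- : #|` A| = #|` F|.
      by apply: card_in_imfset => a b aF bF /finj; apply; rewrite inE; apply: FE.
    rewrite count_map -size_filter; apply: perm_size; apply: uniq_perm;
      [by rewrite filter_uniq // iota_uniq|exact: fset_uniq|move=> i].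
    rewrite mem_filter mem_iota /= add0n.
    case iA: (i \in A) => //=; by rewrite leN ?iA.
  transitivity (lebesgue_measure (digit_event p c 0 1)).
    congr (lebesgue_measure _).
    rewrite /digit_event add0r setIC; congr (_ `&` _); apply/seteqP; split => t h.
      by move=> i; rewrite nthc => /imfsetP[e eF ->]; exact: h.
    by move=> e eF; apply: h; rewrite nthc; apply: in_imfset.
  by have [_ ->] := lebesgue_digit_event c 0 p01 (ler01); rewrite mul1r cc.
split => //.
- by move=> e _; exact: measurable_digit.
- move=> e eE; rewrite -[p in RHS]expr1 -(cardfs1 e) -indep.
    by congr lebesgue01; apply/seteqP; split => [t h a /=|t];
      [rewrite inE => /eqP->|apply; rewrite /= inE].
  by move=> a; rewrite inE => /eqP->.
Qed.

(** * Infinite clusters, their measurability, and absence of percolation for small [p] *)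

(** If there is no simple open walk of length [n], every vertex of the cluster ends a walk of fewer
    than [n] steps, and these are finitely many. Conversely, a simple open walk with as many steps
    as the cluster has vertices visits one vertex too many. *)
Lemma infinite_clusterP (V : choiceType) (nbr : V -> {fset V}) (w : {fset V} -> bool) (x : V) :
  ~ finite_set (open_cluster nbr w x) <->
  forall n, exists s, [/\ s \in walks nbr n x, uniq (x :: s) &
    forall e, e \in walk_edges x s -> w e].
Proof.
pose r a b := (b \in nbr a) && w [fset a; b]%fset.
split.
- move=> inf n; apply: contrapT => none; apply: inf.
  pose L := flatten [seq [seq last x s | s <- walks nbr m x] | m <- iota 0 n].
  apply: (@sub_finite_set _ _ [set` L]); last exact: finite_seq.
  move=> y [s [/shortenP[s' ps' us' _] ls']] /=.
  (* Otherwise the first [n] steps would form a simple open walk of length [n]. *)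
  have sn : (size s' < n)%N.
    rewrite ltnNge; apply/negP => ns; apply: none; exists (take n s').
    have pt : path r x (take n s') by exact: take_path.
    have [pa wa] := (path_adj_open nbr w x _).1 pt.
    split => //; first by rewrite mem_walks size_takel // eqxx.
    by rewrite -[x :: take _ _]/(take n.+1 (x :: s')) take_uniq.
  apply/flatten_mapP; exists (size s'); first by rewrite mem_iota.
  apply/mapP; exists s' => //; rewrite mem_walks eqxx /=.
  by have [] := (path_adj_open nbr w x _).1 ps'.
- move=> long fin; pose C := fset_set (open_cluster nbr w x).
  have [s [sn us ws]] := long #|` C|.
  move: sn; rewrite mem_walks => /andP[/eqP sn ps].
  have pr : path r x s by apply/path_adj_open.
  suff : (#|` [fset y in x :: s]%fset| <= #|` C|)%N.
    by rewrite card_fseq undup_id // /= sn ltnn.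
  apply: fsubset_leq_card; apply/fsubsetP => y; rewrite in_fset /= => ys.
  rewrite in_fset_set // inE; move: ys; rewrite inE => /orP[/eqP->|ys]; first by exists [::].
  case: (splitPr ys) pr => s1 s2; rewrite -cat_rcons cat_path => /andP[pr _].
  by exists (rcons s1 y); rewrite last_rcons.
Qed.

Definition simple_open_walk (V : choiceType) (nbr : V -> {fset V}) (T : Type)
    (omega : T -> {fset V} -> bool) (x : V) (n : nat) : set T :=
  \big[setU/set0]_(s <- [seq s <- walks nbr n x | uniq (x :: s)])
    open_on omega (walk_edges x s).

(** A countable intersection of finite unions: this gives both measurability and an upper bound by
    each simple walk event. *)
Lemma infinite_cluster_eventE (V : choiceType) (nbr : V -> {fset V}) (T : Type)
    (omega : T -> {fset V} -> bool) (x : V) :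
  infinite_cluster_event nbr omega x = \bigcap_n simple_open_walk nbr omega x n.
Proof.
apply/seteqP; split => t.
  move=> /infinite_clusterP h n _; have [s [sw us os]] := h n.
  by apply/bigsetU_seqP; exists s => //; rewrite mem_filter us.
move=> h; apply/infinite_clusterP => n.
have /bigsetU_seqP[s] := h n I; rewrite mem_filter => /andP[us sw] os.
by exists s.
Qed.

(** There are at most [D ^ n] walks, and a simple one has [n] distinct edges, so it is open with
    probability [p ^+ n]. *)
Lemma simple_open_walk_le (R : realType) (V : choiceType) (nbr : V -> {fset V}) (D : nat)
    (p : R) (d : measure_display) (T : measurableType d) (P : probability T R)
    (omega : T -> {fset V} -> bool) (x : V) (n : nat) :
  (forall x, (#|` nbr x| <= D)%N) -> 0 <= p ->
  bernoulli_bond_percolation nbr p P omega ->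
  measurable (simple_open_walk nbr omega x n) /\
  (P (simple_open_walk nbr omega x n) <= ((D%:R * p) ^+ n)%:E)%E.
Proof.
move=> hD p0 [mo _ indep].
have [|s|mU PU] := @measure_bigsetU_le R d T P _ [seq s <- walks nbr n x | uniq (x :: s)]
  (fun s => open_on omega (walk_edges x s)) (p ^+ n).
- move=> s; rewrite mem_filter mem_walks => /and3P[_ _ ps].
  by apply: measurable_open_on => e /(walk_edges_is_edge ps); exact: mo.
- rewrite mem_filter mem_walks => /and3P[us /eqP sn ps].
  by rewrite indep ?card_walk_edges_uniq ?sn // => e; exact: walk_edges_is_edge ps.
split => //; apply: le_trans PU _; rewrite lee_fin exprMn ler_wpM2r ?exprn_ge0 //.
rewrite -natrX ler_nat (leq_trans _ (size_walks_le n x hD)) // size_filter.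
exact: count_size.
Qed.

Lemma measurable_infinite_cluster (R : realType) (V : choiceType) (nbr : V -> {fset V})
    (D : nat) (p : R) (d : measure_display) (T : measurableType d) (P : probability T R)
    (omega : T -> {fset V} -> bool) (x : V) :
  (forall x, (#|` nbr x| <= D)%N) -> 0 <= p ->
  bernoulli_bond_percolation nbr p P omega ->
  measurable (infinite_cluster_event nbr omega x).
Proof.
move=> hD p0 B; rewrite infinite_cluster_eventE; apply: bigcapT_measurable => n.
exact: (simple_open_walk_le x n hD p0 B).1.
Qed.

(** First moment bound on long simple open walks; it is the source of the positivity of the
    threshold. *)
Lemma theta_zero_small (R : realType) (V : choiceType) (nbr : V -> {fset V}) (D : nat)
    (p : R) (x : V) :
  (forall x, (#|` nbr x| <= D)%N) -> 0 <= p -> D%:R * p <= 2^-1 -> theta_zero nbr p x.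
Proof.
move=> hD p0 Dp d T P omega B.
have mI := measurable_infinite_cluster x hD p0 B.
have [r Er] : exists r, P (infinite_cluster_event nbr omega x) = r%:E.
  by exists (fine (P (infinite_cluster_event nbr omega x))); rewrite fineK // fin_num_measure.
have r0 : 0 <= r by rewrite -lee_fin -Er.
have le_r n : r <= 2^-1 ^+ n.
  have [mW PW] := simple_open_walk_le x n hD p0 B.
  rewrite -lee_fin -Er; apply: le_trans (_ : P (simple_open_walk nbr omega x n) <= _)%E.
    apply: le_measure; rewrite ?inE // infinite_cluster_eventE => t; exact.
  apply: le_trans PW _; rewrite lee_fin lerXn2r // nnegrE ?mulr_ge0 //.
rewrite Er; congr (_%:E); apply/eqP; rewrite eq_le r0 andbT leNgt; apply/negP => rpos.
(* Since [r^-1 < n <= 2 ^ n], the bound [le_r] at this [n] contradicts [0 < r]. *)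
pose n := Num.bound r^-1.
have rn : r^-1 < n%:R by apply: archi_boundP; rewrite invr_ge0.
have : n%:R * r <= 1.
  apply: le_trans (_ : (2 ^ n)%N%:R * 2^-1 ^+ n <= 1); last first.
    by rewrite natrX -exprMn mulfV ?expr1n ?pnatr_eq0.
  by apply: ler_pM => //; rewrite ler_nat ltnW // ltn_expl.
by apply/negP; rewrite -ltNge -ltr_pdivrMr // div1r.
Qed.

(** * Contour trees, geodesic rays and the boundary of a finite open cluster *)

Lemma is_edge_adj (V : choiceType) (nbr : V -> {fset V}) (a b : V) :
  simple_graph nbr -> is_edge nbr [fset a; b]%fset -> adjb nbr a b.
Proof.
move=> [irr sym] [x [y [yx E]]].
have xy : x != y by apply: contraTneq yx => ->; exact: irr.
have : (x \in [fset a; b]%fset) && (y \in [fset a; b]%fset).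
  by rewrite E !inE !eqxx orbT.
rewrite !inE /adjb => /andP[/orP[/eqP xa|/eqP xb] /orP[/eqP ya|/eqP yb]].
- by move: xy; rewrite xa ya eqxx.
- by rewrite -xa -yb.
- by rewrite -xb -ya sym.
- by move: xy; rewrite xb yb eqxx.
Qed.

Lemma mem_edge_boundary (V : choiceType) (nbr : V -> {fset V}) (W : {fset V}) (e : {fset V}) :
  e \in edge_boundary nbr W <->
  exists x y, [/\ x \in W, y \in nbr x, y \notin W & e = [fset x; y]%fset].
Proof.
split; first by case/imfset2P => x /= xW [y]; rewrite inE => /andP[yx yW] ->; exists x, y.
case=> x [y [xW yx yW ->]]; apply/imfset2P; exists x => //; exists y => //.
by rewrite inE /= yx.
Qed.

Lemma edge_boundary_is_edge (V : choiceType) (nbr : V -> {fset V}) (W : {fset V}) e :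
  e \in edge_boundary nbr W -> is_edge nbr e.
Proof. by case/mem_edge_boundary => x [y [_ yx _ ->]]; exists x, y. Qed.

Lemma contour_tree_is_edge (V : choiceType) (nbr : V -> {fset V}) (W U : {fset V})
    (F : {fset {fset V}}) e :
  contour_tree nbr W U F -> e \in F -> is_edge nbr e.
Proof.
case=> _ _ FE _ /FE [[x [y [yx -> _]]]|]; first by exists x, y.
exact: edge_boundary_is_edge.
Qed.

Lemma tree_edge_mem (V : choiceType) (U : {fset V}) (F : {fset {fset V}}) (a b : V) :
  is_tree U F -> [fset a; b]%fset \in F -> a \in U /\ b \in U.
Proof.
case=> _ FU _ _ /FU [x [y [xU yU _ E]]].
have : (a \in [fset x; y]%fset) && (b \in [fset x; y]%fset).
  by rewrite -E !inE !eqxx orbT.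
by rewrite !inE => /andP[/orP[/eqP->|/eqP->] /orP[/eqP->|/eqP->]].
Qed.

Lemma inf_ge0 (R : realType) (E : set R) : (forall x, E x -> 0 <= x) -> 0 <= inf E.
Proof.
move=> E0; have [->|/set0P Ene] := eqVneq E set0; first by rewrite inf0.
exact: lb_le_inf.
Qed.

(* Positivity of the contour constant excludes the junk values
   inf set0 = 0 and x / 0 = 0, so that contour trees exist. *)
Lemma contour_tree_exists (R : realType) (V : choiceType) (nbr : V -> {fset V})
    (W : {fset V}) :
  0 < contour_constant R nbr -> in_AG nbr W ->
  exists U F, contour_tree nbr W U F /\
    contour_constant R nbr * #|` F|%:R <= #|` edge_boundary nbr W|%:R.
Proof.
move=> Rpos WA; pose E := [set F | exists U, contour_tree nbr W U F].
have tree_dist_ge0 W' : 0 <= tree_dist R nbr W' by apply: inf_ge0 => _ [F _ <-].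
have ratio : contour_constant R nbr <= #|` edge_boundary nbr W|%:R / tree_dist R nbr W.
  apply: ge_inf; last by exists W.
  by exists 0 => _ [W' _ <-]; apply: divr_ge0.
have dpos : 0 < tree_dist R nbr W.
  rewrite lt_neqAle tree_dist_ge0 andbT; apply/eqP => d0.
  by move: ratio; rewrite -d0 invr0 mulr0 leNgt Rpos.
have [F0 EF0] : E !=set0.
  apply/set0P/eqP => E0; move: dpos.
  by rewrite /tree_dist -/E E0 image_set0 inf0 ltxx.
(* The tree distance is an infimum of natural numbers, so a tree with the fewest edges can be
   taken. *)
have exn : exists n, `[< exists2 F, E F & #|` F| = n >].
  by exists #|` F0|; apply/asboolP; exists F0.
case: (ex_minnP exn) => n /asboolP[F [U FU] <-] minF.
exists U, F; split => //.
apply: le_trans (_ : contour_constant R nbr * tree_dist R nbr W <= _).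
  rewrite ler_pM2l //; apply: lb_le_inf; first by exists #|` F|%:R, F => //; exists U.
  move=> _ [F' EF' <-]; rewrite ler_nat; apply: minF.
  by apply/asboolP; exists F'.
by rewrite -ler_pdivlMr.
Qed.

(** The index of a vertex on the ray is its distance to the origin. *)
Lemma geodesic_ray_inj (V : choiceType) (nbr : V -> {fset V}) (r : nat -> V) :
  geodesic_ray nbr r -> injective r.
Proof.
case=> _ h n m rnm; have [wn minn] := h n; have [wm minm] := h m.
apply/eqP; rewrite eqn_leq minn ?rnm // minm //; last by rewrite -rnm.
Qed.

Lemma ray_exit (V : choiceType) (r : nat -> V) (W : {fset V}) :
  injective r -> r 0%N \in W -> exists n, r n \in W /\ r n.+1 \notin W.
Proof.
move=> rinj r0; apply: contrapT => noexit.
have allW n : r n \in W.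
  elim: n => // n IH; apply: contrapT => /negP rn; apply: noexit; by exists n.
have := @uniq_leq_size _ (map r (iota 0 #|` W|.+1)) (enum_fset W).
rewrite map_inj_uniq // iota_uniq size_map size_iota ltnn => /(_ isT) h.
by have : false by apply: h => _ /mapP[n _ ->].
Qed.

(** The tree contains a simple path from [r1 n.+1] to [r2 m.+1]. Its edges are distinct elements of
    [F], and the geodesic property bounds its length below. A contour tree thus cannot reach far
    along a ray without being large. *)
Lemma geodesic_contour_length (V : choiceType) (nbr : V -> {fset V}) (r1 r2 : nat -> V)
    (W U : {fset V}) (F : {fset {fset V}}) (n m : nat) :
  simple_graph nbr ->
  (forall n m, is_dist nbr (r1 n) (r2 m) (n + m)) ->
  contour_tree nbr W U F ->
  [fset r1 n; r1 n.+1]%fset \in F -> [fset r2 m; r2 m.+1]%fset \in F ->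
  (n.+1 + m.+1 <= #|` F|)%N.
Proof.
move=> sg hd cF e1 e2; have [tF _ _ _] := cF.
have [_ u1] := tree_edge_mem tF e1; have [_ u2] := tree_edge_mem tF e2.
have [_ _ conn _] := tF.
have [s [/shortenP[s' ps' us' _] _ ls']] := conn _ _ u1 u2.
have psF := ps'; rewrite path_frel in psF.
rewrite (leq_trans _ (fsubset_leq_card psF)) // (card_walk_edges_uniq us').
apply: (hd _ _).2; exists s'; split => //.
apply: sub_path ps' => a b abF; apply: is_edge_adj => //.
exact: contour_tree_is_edge cF abF.
Qed.

(** Encodes a contour by data that can be counted: the exit index [n] on the first ray and a walk
    from there that sweeps a contour tree with [k.+1] edges. *)
Lemma contour_walk (R : realType) (V : choiceType) (nbr : V -> {fset V})
    (r1 r2 : nat -> V) (W : {fset V}) :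
  simple_graph nbr -> 0 < contour_constant R nbr ->
  r1 0%N = r2 0%N -> geodesic_ray nbr r1 -> geodesic_ray nbr r2 ->
  (forall n m, is_dist nbr (r1 n) (r2 m) (n + m)) ->
  in_AG nbr W -> r1 0%N \in W ->
  exists n k s, [/\ (n < k)%N, s \in walks nbr (2 * k.+1) (r1 n),
    #|` walk_edges (r1 n) s| = k.+1, (edge_boundary nbr W `<=` walk_edges (r1 n) s)%fset &
    contour_constant R nbr * k.+1%:R <= #|` edge_boundary nbr W|%:R].
Proof.
move=> sg Rpos r12 g1 g2 hd WA r1W.
have [U [F [cF RF]]] := contour_tree_exists Rpos WA.
have [n [nW n1W]] := ray_exit (geodesic_ray_inj g1) r1W.
have r2W : r2 0%N \in W by rewrite -r12.
have [m [mW m1W]] := ray_exit (geodesic_ray_inj g2) r2W.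
have [tF _ _ bF] := cF.
have e1 : [fset r1 n; r1 n.+1]%fset \in F.
  by apply: (fsubsetP bF); apply/mem_edge_boundary;
    exists (r1 n), (r1 n.+1); split => //; exact: g1.1.
have e2 : [fset r2 m; r2 m.+1]%fset \in F.
  by apply: (fsubsetP bF); apply/mem_edge_boundary;
    exists (r2 m), (r2 m.+1); split => //; exact: g2.1.
have nm := geodesic_contour_length sg hd cF e1 e2.
have [k cFk] : exists k, #|` F| = k.+1 by case: #|` F| nm => // k; exists k.
have [u1 _] := tree_edge_mem tF e1.
have [_ FU conn _] := tF.
have [s [ps ss sF]] := covering_walk FU conn u1.
(* From [n.+1 + m.+1 <= k.+1], so that only [k] starting points occur for a tree with [k.+1]
   edges. *)
have nk : (n < k)%N by apply: leq_trans (leq_addr m _) _; rewrite -ltnS -addnS -cFk.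
exists n, k, s; rewrite sF -cFk; split; [exact: nk| |by []|exact: bF|exact: RF].
rewrite mem_walks ss eqxx /=.
apply: sub_path ps => a b abF; apply: is_edge_adj => //.
exact: contour_tree_is_edge cF abF.
Qed.

(** Open walks from [x] never leave the cluster, so any two of its vertices are joined inside it
    through [x]; an open boundary edge would enlarge it. *)
Lemma open_cluster_in_AG (V : choiceType) (nbr : V -> {fset V}) (w : {fset V} -> bool)
    (x : V) :
  simple_graph nbr -> finite_set (open_cluster nbr w x) ->
  let W := fset_set (open_cluster nbr w x) in
  in_AG nbr W /\ forall e, e \in edge_boundary nbr W -> ~~ w e.
Proof.
move=> [irr sym] fin W.
have WP y : (y \in W) = (y \in open_cluster nbr w x) by rewrite in_fset_set.
have xW : x \in W by rewrite WP inE; exists [::].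
pose r := fun a b => (b \in nbr a) && w [fset a; b]%fset.
pose q := fun a b => (b \in nbr a) && (a \in W) && (b \in W).
have qsym : q =2 (fun a b => q b a) by move=> a b; rewrite /q sym andbAC.
have stepW a b : a \in W -> r a b -> b \in W.
  rewrite !WP !inE => -[s [ps ls]] rab; exists (rcons s b).
  by rewrite rcons_path last_rcons ps ls.
have pathW a s : a \in W -> path r a s -> path q a s /\ all (fun z => z \in W) s.
  elim: s a => [|b s IH] a aW //= /andP[rab ps].
  have bW := stepW _ _ aW rab; have [pq al] := IH b bW ps.
  by rewrite /q aW bW al pq; split => //; case/andP: rab => ->.
have fromx y : y \in W -> exists s, [/\ path q x s, all (fun z => z \in W) s & last x s = y].
  rewrite WP inE => -[s [ps ls]]; exists s.
  by have [] := pathW _ _ xW ps.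
split; [split; first by apply/fset0Pn; exists x|].
  move=> a b aW bW; have [s1 [p1 al1 l1]] := fromx a aW; have [s2 [p2 al2 l2]] := fromx b bW.
  (* The walk from [x] to [a] taken backwards, then the walk from [x] to [b]. *)
  exists (rev (belast x s1) ++ s2); rewrite cat_path all_cat last_cat.
  have la : last a (rev (belast x s1)) = x.
    by case: (s1) l1 => [|c s] //= _; rewrite rev_cons last_rcons.
  rewrite la; split => //.
    rewrite p2 andbT -l1 rev_path.
    by rewrite -(eq_path qsym).
  rewrite al2 andbT all_rev; apply/allP => z /mem_belast.
  by rewrite inE => /orP[/eqP->//|]; exact: (allP al1).
move=> e /mem_edge_boundary[a [b [aW ba bW ->]]]; apply: contra bW => wab.
by apply: stepW aW _; rewrite /r ba.
Qed.

(** * Counting candidate contours, and the estimates for the Peierls sum *)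

(** A list containing the boundaries to be considered, made easy to count: [S] need not be a
    boundary, and repetitions are allowed. The index [j] stands for trees with [j.+1] edges. *)
Definition contour_candidates (R : realType) (V : choiceType) (nbr : V -> {fset V})
    (r : nat -> V) (c : R) (j : nat) : seq {fset {fset V}} :=
  flatten [seq flatten
    [seq [seq S <- enum_fset (fpowerset (walk_edges (r n) s)) | c * j.+1%:R <= #|` S|%:R]
      | s <- [seq s <- walks nbr (2 * j.+1) (r n) | #|` walk_edges (r n) s| == j.+1]]
    | n <- iota 0 j].

Lemma mem_contour_candidates (R : realType) (V : choiceType) (nbr : V -> {fset V})
    (r : nat -> V) (c : R) (j : nat) (S : {fset {fset V}}) :
  S \in contour_candidates nbr r c j <->
  exists n s, [/\ (n < j)%N, s \in walks nbr (2 * j.+1) (r n),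
    #|` walk_edges (r n) s| = j.+1, (S `<=` walk_edges (r n) s)%fset &
    c * j.+1%:R <= #|` S|%:R].
Proof.
split.
  case/flatten_mapP => n; rewrite mem_iota add0n => /andP[_ nj].
  case/flatten_mapP => s; rewrite mem_filter => /andP[/eqP cs sw].
  rewrite mem_filter => /andP[cS]; rewrite fpowersetE => Ss.
  by exists n, s.
case=> n [s [nj sw cs Ss cS]].
apply/flatten_mapP; exists n; first by rewrite mem_iota.
apply/flatten_mapP; exists s; first by rewrite mem_filter cs eqxx.
by rewrite mem_filter cS fpowersetE.
Qed.

(** The factors count starting points on the ray, walks, and subsets of the [j.+1] edges of a
    walk. *)
Lemma size_contour_candidates (R : realType) (V : choiceType) (nbr : V -> {fset V})
    (D : nat) (r : nat -> V) (c : R) (j : nat) :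
  (forall x, (#|` nbr x| <= D)%N) ->
  (size (contour_candidates nbr r c j) <= j * (D ^ (2 * j.+1) * 2 ^ j.+1))%N.
Proof.
move=> hD; rewrite -[X in (_ <= X * _)%N](size_iota 0).
apply: size_flatten_le => n _.
apply: leq_trans (size_flatten_le (m := (2 ^ j.+1)%N) _) _.
  move=> s; rewrite mem_filter => /andP[/eqP cs _].
  by rewrite size_filter (leq_trans (count_size _ _)) // -cs -card_fpowerset.
rewrite leq_mul2r (leq_trans _ (size_walks_le (2 * j.+1) (r n) hD)) ?orbT //.
by rewrite size_filter count_size.
Qed.

(** Since [X] is at least 1, q^m <= X^(-m/c) <= X^(-k). With [c] the contour constant, this is where
    the exponent 1/R_G of the theorem arises. *)
Lemma exprn_le_powR_inv (R : realType) (X q c : R) (k m : nat) :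
  1 <= X -> 0 < c -> 0 <= q -> q <= (X `^ c^-1)^-1 -> c * k%:R <= m%:R ->
  q ^+ m <= X^-1 ^+ k.
Proof.
move=> X1 c0 q0 qX ckm; have X0 : 0 < X by exact: lt_le_trans X1.
apply: le_trans (_ : (X `^ c^-1)^-1 ^+ m <= _).
  by apply: lerXn2r => //; rewrite nnegrE invr_ge0 powR_ge0.
rewrite -powRN -powR_mulrn ?powR_ge0 // -powRrM exprVn -powR_invn ?(ltW X0) //.
apply: ler_powR => //; rewrite mulNr lerN2.
by rewrite mulrC ler_pdivlMr // mulrC.
Qed.

(** Comparison with the case y = 1/2, where the sum of j / 2^(j+1) over j < N is 1 - (N+1) / 2^N,
    hence at most 1. *)
Lemma sum_arith_geom_le (R : realType) (y b : R) (u : nat -> \bar R) :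
  0 <= y -> 2 * y <= 1 -> 0 <= b ->
  (forall j, (0 <= u j)%E) ->
  (forall j, (u j <= (j%:R * y ^+ j.+1 * b)%:E)%E) ->
  (\sum_(0 <= j <oo) u j <= ((2 * y) ^+ 2 * b)%:E)%E.
Proof.
move=> y0 y1 b0 u0 uy; have yy0 : 0 <= 2 * y by rewrite mulr_ge0.
apply: lime_le; first by apply: is_cvg_nneseries => j _ _; exact: u0.
apply: nearW => N.
apply: le_trans (_ : ((2 * y) ^+ 2 * b * (1 - N.+1%:R / 2 ^+ N))%:E <= _)%E; last first.
  by rewrite lee_fin ler_piMr // mulr_ge0 ?exprn_ge0.
elim: N => [|N IH]; first by rewrite big_geq // lee_fin expr0 divr1 subrr mulr0.
rewrite big_nat_recr //=; apply: le_trans (leeD IH (uy N)) _.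
rewrite -EFinD lee_fin -lerBrDl.
have -> : (2 * y) ^+ 2 * b * (1 - N.+2%:R / 2 ^+ N.+1) -
   (2 * y) ^+ 2 * b * (1 - N.+1%:R / 2 ^+ N) = (2 * y) ^+ 2 * b * (N%:R / 2 ^+ N.+1).
  rewrite [2 ^+ N.+1]exprS -[N.+2%:R]natr1 -[N.+1%:R]natr1.
  by field; rewrite expf_neq0.
rewrite [X in _ <= X]mulrAC ler_wpM2r // [X in _ <= X]mulrCA.
(* The term of index 0 vanishes; in the others the exponent of [2 * y] is at least 2, which yields
   the factor [(2 * y) ^+ 2]. *)
case: N {IH} => [|N]; first by rewrite !mul0r.
rewrite ler_pM2l ?ltr0n // ler_pdivlMr ?exprn_gt0 // mulrC -exprMn.
by rewrite -[N.+2]addn2 exprD ler_piMl ?exprn_ge0 ?exprn_ile1 ?mulr_ge0.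
Qed.

(** * The Peierls argument and the resulting bounds on the threshold *)

(** Were the infinite cluster event null, the event that the path from [x] to the origin is open, of
    probability p^g, would be almost surely covered by the contour events [A j], of total
    probability at most (2/e)^2 p^g. *)
Lemma theta_pos (R : realType) (V : choiceType) (nbr : V -> {fset V}) (D : nat)
    (r1 r2 : nat -> V) (p : R) (x : V) :
  simple_graph nbr -> graph_connected nbr -> (forall x, (#|` nbr x| <= D)%N) -> (0 < D)%N ->
  0 < contour_constant R nbr ->
  r1 0%N = r2 0%N -> geodesic_ray nbr r1 -> geodesic_ray nbr r2 ->
  (forall n m, is_dist nbr (r1 n) (r2 m) (n + m)) ->
  0 < p <= 1 ->
  1 - p <= ((2 * expR 1 * D%:R ^+ 2) `^ (contour_constant R nbr)^-1)^-1 ->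
  ~ theta_zero nbr p x.
Proof.
move=> sg conn hD D0 Rpos r12 g1 g2 hd /andP[p0 p1] qX th0.
set c := contour_constant R nbr in Rpos qX; set X := 2 * expR 1 * D%:R ^+ 2 in qX.
have p01 : 0 <= p <= 1 by rewrite (ltW p0).
have q0 : 0 <= 1 - p by rewrite subr_ge0.
have e2 : 2 < expR 1 :> R.
  by have := @expR_gt1Dx R 1 (oner_neq0 _).
have D1 : 1 <= D%:R ^+ 2 :> R by rewrite exprn_ege1 // ler1n.
have X1 : 1 <= X.
  by apply: mulr_ege1 => //; apply: mulr_ege1; lra.
have [omega B] := bernoulli_exists x conn p01.
have [mo _ indep] := B.
have [g0 [s0 [_ ps0 ls0]]] := conn x (r1 0%N).
pose G := walk_edges x s0.
have GE e : e \in G -> is_edge nbr e by exact: walk_edges_is_edge ps0.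
pose inf := infinite_cluster_event nbr omega x.
have minf : measurable inf by exact: measurable_infinite_cluster hD (ltW p0) B.
have Pinf : lebesgue01 inf = 0%E by exact: th0 B.
pose A j := \big[setU/set0]_(S <- contour_candidates nbr r1 c j)
  (open_on omega G `&` closed_on omega S).
have candE j S : S \in contour_candidates nbr r1 c j -> forall e, e \in S -> is_edge nbr e.
  case/mem_contour_candidates => n [s [_ sw _ Ss _]] e /(fsubsetP Ss).
  by move: sw; rewrite mem_walks => /andP[_ ps]; exact: walk_edges_is_edge ps.
have AP j : measurable (A j) /\
    (lebesgue01 (A j) <= (j%:R * (expR 1)^-1 ^+ j.+1 * p ^+ #|` G|)%:E)%E.
  have [||mA PA] := @measure_bigsetU_le R _ _ (@lebesgue01 R) _
    (contour_candidates nbr r1 c j) (fun S => open_on omega G `&` closed_on omega S)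
    (p ^+ #|` G| * X^-1 ^+ j.+1).
  - move=> S Sc; apply: measurableI.
      by apply: measurable_open_on => e /GE; exact: mo.
    by apply: measurable_closed_on => e /(candE _ _ Sc); exact: mo.
  - move=> S Sc; apply: le_trans (bernoulli_open_closed_le p01 B GE (candE _ _ Sc)) _.
    rewrite lee_fin ler_wpM2l ?exprn_ge0 ?(ltW p0) //.
    case/mem_contour_candidates: Sc => n [s [_ _ _ _ cS]].
    exact: exprn_le_powR_inv cS.
  split => //; apply: le_trans PA _; rewrite lee_fin.
  apply: le_trans (_ : (j * (D ^ (2 * j.+1) * 2 ^ j.+1))%N%:R * (p ^+ #|` G| * X^-1 ^+ j.+1) <= _).
    rewrite ler_wpM2r ?mulr_ge0 ?exprn_ge0 ?invr_ge0 ?(ltW p0) ?(le_trans _ X1) //.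
    by rewrite ler_nat size_contour_candidates.
  rewrite !natrM !natrX exprM mulrAC -!mulrA [X in _ * X <= _]mulrCA -exprMn.
  (* The constant [X] is chosen so that the count (2 D^2)^(j+1) of walks and subsets, multiplied by
     X^(-(j+1)), leaves exactly e^(-(j+1)). *)
  have -> : (expR 1)^-1 = D%:R ^+ 2 * (2 * X^-1) :> R.
    rewrite /X; field; rewrite ?lt0r_neq0 ?expR_gt0 ?ltr0n //.
  rewrite !exprMn le_eqVlt; apply/orP; left; apply/eqP.
  by move: (_ ^+ _) (_ ^+ _) (_ ^+ _) (_ ^+ _) => a1 a2 a3 a4; ring.
(* The null event [inf] is joined to every [A j], which turns the almost sure cover into a genuine
   one without changing the bounds. *)
have cover : open_on omega G `<=` \bigcup_j (A j `|` inf).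
  move=> t oG; have [fin|?] := pselect (finite_set (open_cluster nbr (omega t) x)); last first.
    by exists 0%N => //; right.
  have [WA Wcl] := open_cluster_in_AG sg fin.
  (* The open path puts the origin of both rays into the cluster of [x], so each ray has to leave
     this finite cluster. *)
  have oW : r1 0%N \in fset_set (open_cluster nbr (omega t) x).
    rewrite in_fset_set // inE; exists s0; split => //.
    exact/path_adj_open.
  have [n [k [s [nk sw cs bs cb]]]] := contour_walk sg Rpos r12 g1 g2 hd WA oW.
  exists k => //; left; apply/bigsetU_seqP.
  exists (edge_boundary nbr (fset_set (open_cluster nbr (omega t) x))).
    by apply/mem_contour_candidates; exists n, s.
  by split.
have mG : measurable (open_on omega G).
  by apply: measurable_open_on => e /GE; exact: mo.
have PG : lebesgue01 (open_on omega G) = (p ^+ #|` G|)%:E by exact: indep GE.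
have : (lebesgue01 (open_on omega G) <= ((2 * (expR 1)^-1) ^+ 2 * p ^+ #|` G|)%:E)%E.
  apply: le_trans (measure_sigma_subadditive (@lebesgue01 R) _ mG cover) _.
    by move=> j; apply: measurableU => //; exact: (AP j).1.
  apply: sum_arith_geom_le.
  - by rewrite invr_ge0 expR_ge0.
  - by rewrite ler_pdivrMr ?expR_gt0 // mul1r ltW.
  - by rewrite exprn_ge0 // ltW.
  - by move=> j; exact: measure_ge0.
  - move=> j; apply: le_trans (measureU2 _ (AP j).1 minf) _.
    by rewrite [X in (_ + X)%E]Pinf adde0; exact: (AP j).2.
rewrite PG lee_fin; apply/negP; rewrite -ltNge gtr_pMl ?exprn_gt0 //.
rewrite exprn_ilt1 // ?mulr_ge0 ?invr_ge0 ?expR_ge0 //.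
by rewrite ltr_pdivrMr ?expR_gt0 // mul1r.
Qed.

Theorem theorem3p1 (R : realType) (V : choiceType) (nbr : V -> {fset V})
  (Delta : nat) :
  simple_graph nbr ->
  graph_infinite V ->
  graph_connected nbr ->
  is_max_degree nbr Delta ->
  0 < contour_constant R nbr ->
  has_biinfinite_geodesic nbr ->
  forall x : V,
    0 < p_c R nbr x /\ p_c R nbr x < 1 /\
    p_c R nbr x <=
      1 - (2 * ((2 * expR 1 * (Delta%:R) ^+ 2) `^ ((contour_constant R nbr)^-1)))^-1.
Proof.
move=> sg _ conn [hD _] Rpos [r1 [r2 [r12 g1 g2 hd]]] x.
have D0 : (0 < Delta)%N.
  apply: leq_trans (hD (r1 0%N)); rewrite cardfs_gt0.
  by apply/fset0Pn; exists (r1 1%N); exact: g1.1.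
set Y := _ `^ _.
have Y1 : 1 <= Y.
  have D1 : 1 <= Delta%:R ^+ 2 :> R by rewrite exprn_ege1 // ler1n.
  have e2 : 2 < expR 1 :> R by have := @expR_gt1Dx R 1 (oner_neq0 _).
  rewrite -[1](powRr0 (2 * expR 1 * Delta%:R ^+ 2)) ler_powR ?invr_ge0 ?(ltW Rpos) //.
  by apply: mulr_ege1 => //; apply: mulr_ege1; lra.
have Y2 : (2 * Y)^-1 <= Y^-1 by rewrite lef_pV2 ?posrE; lra.
have Yinv : Y^-1 <= 1 by rewrite invf_le1 //; lra.
have Y0 : 0 < (2 * Y)^-1 by rewrite invr_gt0; lra.
have Yhalf : (2 * Y)^-1 <= 2^-1 by rewrite lef_pV2 ?posrE; lra.
pose E := [set p : R | 0 <= p <= 1 /\ theta_zero nbr p x].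
have d0 : 0 < (2 * Delta%:R)^-1 :> R by rewrite invr_gt0 mulr_gt0 ?ltr0n.
(* This element bounds the supremum below by a positive number, and shows that [E] is nonempty. *)
have Ed : E (2 * Delta%:R)^-1.
  have dd : Delta%:R * (2 * Delta%:R)^-1 = 2^-1 :> R.
    by rewrite invfM mulrCA mulfV ?mulr1 // pnatr_eq0 -lt0n.
  split; last by apply: theta_zero_small hD (ltW d0) _; rewrite dd.
  rewrite (ltW d0) invf_le1 ?mulr_gt0 ?ltr0n //.
  have : 1 <= Delta%:R :> R by rewrite ler1n.
  lra.
have ubE : ubound E (1 - (2 * Y)^-1).
  move=> p [/andP[p0 p1] th]; rewrite leNgt; apply/negP => pY.
  (* Here [1 - p < (2 * Y)^-1 <= Y^-1], and [p] is positive because [(2 * Y)^-1] is at most 1/2. *)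
  apply: (theta_pos (D := Delta) (p := p) (x := x) sg conn hD D0 Rpos r12 g1 g2 hd _ _ th).
    by rewrite p1 andbT; lra.
  by rewrite -/Y; lra.
have pc_le : p_c R nbr x <= 1 - (2 * Y)^-1 by apply: ge_sup => //; exists (2 * Delta%:R)^-1.
split; last by split => //; lra.
apply: lt_le_trans d0 _; apply: ub_le_sup => //.
by exists (1 - (2 * Y)^-1).
Qed.
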